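(* There is a strictly monotone increasing unbounded sequence $\Lambda=(\lambda_0,\lambda_1,\ldots)$ of real numbers such that the gaps $\lambda_n-\lambda_{n-1}$ tend to $0$ monotone decreasingly (i.e. $\Lambda$ is a decreasing gap asymptotically dense set), with the following property: for every open set $G\subset\mathbb{R}$ there is a function $f_G:\mathbb{R}\to[0,+\infty)$ of the form $f_G=\chi_{U_G}$ for some closed set $U_G\subset\mathbb{R}$, such that \[ \mu\Big(\Big\{x\notin G : \sum_{n=0}^\infty f_G(x+\lambda_n)=\infty\Big\}\Big)=0 \quad\text{and}\quad \sum_{n=0}^\infty f_G(x+\lambda_n)=\infty \text{ for every } x\in G. \] In particular $D(f_G,\Lambda)\supset G$ and $C(f_G,\Lambda)=\mathbb{R}\setminus G$ modulo sets of Lebesgue measure zero. Moreover, for every open $G\subset\mathbb{R}$ one can also select a function $g_G\in C_0^+(\mathbb{R})$ satisfying the two displayed properties in place of $f_G$.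
   Context: $\mu$ denotes one-dimensional Lebesgue measure and $\chi_U$ the characteristic function of $U$. For a discrete set $\Lambda\subset\mathbb{R}$ and measurable $f:\mathbb{R}\to[0,+\infty)$, put $s(x)=\sum_{\lambda\in\Lambda}f(x+\lambda)$, $C(f,\Lambda)=\{x: s(x)<\infty\}$ and $D(f,\Lambda)=\{x: s(x)=\infty\}$. $C_0^+(\mathbb{R})$ denotes the set of continuous functions $\mathbb{R}\to[0,+\infty)$ that tend to $0$ at $+\infty$. *)

(* Defs.v *)
From mathcomp Require Import all_boot all_order all_algebra.
From mathcomp Require Import all_classical all_reals all_analysis.
Set Implicit Arguments. Unset Strict Implicit. Unset Printing Implicit Defensive.
Import Order.TTheory GRing.Theory Num.Theory numFieldNormedType.Exports.
Local Open Scope classical_set_scope.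
Local Open Scope ring_scope.

Definition shift_sum {R : realType} (f : R -> R) (lam : nat -> R) (x : R) : \bar R :=
  (\sum_(0 <= n <oo) (f (x + lam n))%:E)%E.

Definition dgad_seq {R : realType} (lam : nat -> R) : Prop :=
  (forall n, lam n < lam n.+1) /\
  (forall M : R, exists n, M < lam n) /\
  (forall n, lam n.+2 - lam n.+1 <= lam n.+1 - lam n) /\
  ((fun n => lam n.+1 - lam n) @ \oo --> (0 : R^o)).

Definition good_for {R : realType} (lam : nat -> R) (G : set R) (h : R -> R) : Prop :=
  (@lebesgue_measure R).-negligible [set x | ~ G x /\ shift_sum h lam x = +oo%E] /\
  (forall x, G x -> shift_sum h lam x = +oo%E).

Definition C0plus {R : realType} (g : R -> R) : Prop :=
  continuous g /\ (forall x, 0 <= g x) /\ (g x @[x --> +oo] --> (0 : R^o)).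

(* Main.v *)
Require Import Defs.
From mathcomp Require Import all_boot all_order all_algebra.
From mathcomp Require Import all_classical all_reals all_analysis.
From mathcomp Require Import zify ring lra.
Import Order.TTheory GRing.Theory Num.Theory numFieldNormedType.Exports.
Local Open Scope classical_set_scope.
Local Open Scope ring_scope.

(* The sequence is an arithmetic progression on long stretches, organised in
   blocks. In block n, around the position s_n, the gap drops from D to
   d = N eta and then to d' = (N - 1) eta, with d much smaller than D, and the
   stretch of gap d is placed so that x sees it from s_n (that is, s_n - x lies
   in it) exactly when x belongs to an interval I_n. The target set of the block
   consists of many pieces of length about eta, spaced d' apart and starting at
   s_n.
   - For x in I_n, the sequence has gap d = d' + eta; the pieces, shifting by eta
     modulo d, cover all residues, so x + lam hits them, as often as prescribed.
   - For x left of I_n, the sequence is in phase with the pieces, so all hits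
     concentrate on a set of x of relative density O(1/N).
   - For x right of I_n, the sequence has gap D, much larger than the total
     length of the pieces, so again few x are hit.
   The I_n cover every point infinitely often by arbitrarily short intervals.
   Given G, the union of the targets of those blocks for which a neighbourhood of
   I_n lies in G works: points of G are hit infinitely often, and Borel-Cantelli
   disposes of the points outside G. Since a point of I_n is hit at least s_n + 2
   times in block n, the series still diverges on G after multiplication of a
   Urysohn function by 1/(1 + |y|). *)

(** * Topological preliminaries *)

Lemma closed_bigcup_escaping (R : realType) (S : set nat) (F : nat -> set R) :
  (forall n, S n -> closed (F n)) ->
  (forall n y, F n y -> n%:R <= y) ->
  closed (\bigcup_(n in S) F n).
Proof.
(* The ball of radius 1 around y meets only those [F n] with n < M, so near y the union is
   finite. *)
move=> cF lF y cly; pose M := (Num.truncn (y + 1)).+1.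
have cG : closed (\bigcup_(n in S `&` `I_M) F n).
  apply: closed_bigcup; first exact: finite_setIr (finite_II M).
  by move=> n [Sn _]; exact: cF.
have [|n [Sn _] Fy] := cG y; last by exists n.
move=> A nA.
have /cly [z [[n Sn Fz] [Az yz]]] : nbhs y (A `&` ball y 1).
  by apply: filterI => //; exact: nbhsx_ballx.
exists z; split=> //; exists n => //; split=> //=.
rewrite /M -(ltr_nat R); apply: le_lt_trans (lF _ _ Fz) _.
apply: lt_trans (truncnS_gt _).
by move: yz; rewrite /ball/= ltr_norml => /andP[]; lra.
Qed.

(** Each point is thickened by half the radius of a ball missing the other set. If two such
    half-balls met, the larger full ball would contain the centre of the other one. *)
Lemma pseudoMetric_normal (R : realType) (T : pseudoMetricType R) :
  normal_space T.
Proof.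
apply/(@normal_openP R T) => A B cA cB AB0.
pose thick (X Y : set T) : set T :=
  \bigcup_(p in [set p : T * {posnum R} |
      X p.1 /\ ball p.1 p.2%:num `&` Y = set0]) (ball p.1 (p.2%:num / 2))°.
have othick X Y : open (thick X Y).
  by apply: bigcup_open => p _; exact: open_interior.
have sub X Y : closed Y -> X `&` Y = set0 -> X `<=` thick X Y.
  move=> cY XY0 x Xx.
  have : nbhs x (~` Y).
    apply: open_nbhs_nbhs; split; first exact: closed_openC.
    by move=> Yx; have : (X `&` Y) x by []; rewrite XY0.
  move=> /nbhs_ballP [e e0 eY]; exists (x, PosNum e0) => /=.
    split=> //; apply/seteqP; split=> // z [xz Yz].
    exact: (eY z).
  rewrite /interior; apply/nbhs_ballP; exists (e / 2) => //=.
  by rewrite divr_gt0.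
exists (thick A B), (thick B A); split; try exact: othick.
- exact: sub.
- by apply: sub => //; rewrite setIC.
apply/seteqP; split=> // z [[[a e]/= [Aa ae] /interior_subset az]].
move=> [[b f]/= [Bb bf] /interior_subset bz].
have ab : ball a (e%:num / 2 + f%:num / 2) b.
  by apply: ball_triangle az (ball_sym bz).
have [ef|fe] := leP f%:num e%:num.
  suff : (ball a e%:num `&` B) b by rewrite ae.
  by split=> //; apply: le_ball ab; lra.
suff : (ball b f%:num `&` A) a by rewrite bf.
by split=> //; apply: ball_sym; apply: le_ball ab; lra.
Qed.

(** * Measure of periodic families of intervals *)

Section periodic_cover.
Context {R : realType}.
Notation mu := (@lebesgue_measure R).

Lemma bigsetU_itv_measure (c e w : R) (P : nat) : 0 <= w ->
  (mu (\big[setU/set0]_(i < P) `[c + i%:R * e, c + i%:R * e + w]%classic)%R <=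
   (P%:R * w)%:E)%E.
Proof.
move=> w0.
apply: le_trans.
  exact: (@Boole_inequality _ _ _ mu
    (fun i => `[c + i%:R * e, c + i%:R * e + w]%classic)).
rewrite (eq_bigr (fun=> w%:E)).
  by rewrite sumEFin sumr_const card_ord mulr_natl.
move=> i _ /=; rewrite lebesgue_measure_itv/= lte_fin -EFinD.
case: ltP => h; congr EFin; lra.
Qed.

(** At most 3 + 2 b / e members of the family meet [-b, b], counted from [k0], the index at which
    they can first reach -b. Since e <= 1, the 3 is absorbed into 3 / e. *)
Lemma periodic_cover (c e w b : R) : 0 < e -> e <= 1 -> 0 <= w -> w <= e ->
  0 <= b -> exists S : set R, [/\ measurable S,
    (mu S <= ((2 * b + 3) * (w / e))%:E)%E &
    forall (x : R) (k : int), - b <= x <= b ->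
      c + k%:~R * e <= x <= c + k%:~R * e + w -> S x].
Proof.
move=> e0 e1 w0 we b0.
pose k0 := Num.floor ((- b - c - w) / e).
pose P := (Num.truncn (2 + 2 * b / e)).+1.
pose F i := `[c + k0%:~R * e + i%:R * e, c + k0%:~R * e + i%:R * e + w]%classic.
exists (\big[setU/set0]_(i < P) F i); split.
- by apply: bigsetU_measurable => i _; exact: measurable_itv.
- apply: le_trans; first exact: bigsetU_itv_measure.
  rewrite lee_fin (_ : _ * (w / e) = (2 * b + 3) / e * w); last by ring.
  rewrite ler_wpM2r//.
  have : P%:R <= 3 + 2 * b / e :> R.
    rewrite /P -natr1.
    have : (Num.truncn (2 + 2 * b / e))%:R <= 2 + 2 * b / e.
      by rewrite truncn_le addr_ge0// divr_ge0 ?mulr_ge0// ltW.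
    by lra.
  have : 1 <= e^-1 by rewrite invf_ge1.
  by lra.
- move=> x k /andP[bx xb] /andP[cx xc].
  have k0P : k0%:~R * e <= - b - c - w.
    by rewrite -ler_pdivlMr// floor_le.
  have k0Q : - b - c - w < (k0 + 1)%:~R * e.
    by rewrite -ltr_pdivrMr// floorD1_gt.
  have kk0 : (k0 <= k)%R.
    rewrite -ltzD1 -(ltr_int R) -(ltr_pM2r e0).
    rewrite intrD mulrDl mul1r; lra.
  have [i ki] : exists i : nat, k = k0 + i%:Z.
    by exists `|k - k0|%N; lia.
  have iP : (i < P)%N.
    rewrite /P -(ltr_nat R).
    apply: le_lt_trans (truncnS_gt _).
    rewrite -(ler_pM2r e0) mulrDl divfK ?gt_eqF//.
    by move: cx xc k0Q; rewrite ki !intrD !mulrDl mul1r -pmulrn; lra.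
  rewrite -(bigcup_mkord P F); exists i => //.
  move: cx xc; rewrite /F/= in_itv/= ki intrD mulrDl -pmulrn !addrA => -> ->//.
Qed.

End periodic_cover.

(** * Sequences driven by a gap function *)

Section gap_driven_sequence.
Context {R : realType} (gam : R -> R).

Definition gap_seq (n : nat) : R := iter n (fun y => y + gam y) 0.

Lemma gap_seqS n : gap_seq n.+1 = gap_seq n + gam (gap_seq n).
Proof. by []. Qed.

Hypothesis gam_gt0 : forall y, 0 < gam y.
Hypothesis gam_ninc : forall x y, x <= y -> gam y <= gam x.

Lemma gap_seq_ltS n : gap_seq n < gap_seq n.+1.
Proof. by rewrite gap_seqS ltrDl. Qed.

Lemma gap_seq_le m n : (m <= n)%N -> gap_seq m <= gap_seq n.
Proof.
move=> mn; apply: (@homo_leq _ gap_seq (<=%R)) => //.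
- exact: le_trans.
- by move=> k; exact/ltW/gap_seq_ltS.
Qed.

(** Below a bound M every gap would be at least [gam M], forcing linear growth. *)
Lemma gap_seq_unbounded M : exists n, M < gap_seq n.
Proof.
apply: contrapT => /forallNP bnd.
have le_M n : gap_seq n <= M by rewrite leNgt; apply/negP/bnd.
have lin n : n%:R * gam M <= gap_seq n.
  elim: n => [|n IH]; first by rewrite mul0r.
  rewrite gap_seqS -natr1 mulrDl mul1r lerD//.
  exact/gam_ninc/le_M.
have M0 : 0 <= M by exact: (le_M 0%N).
have := le_trans (lin (Num.truncn (M / gam M)).+1) (le_M _).
rewrite -ler_pdivlMr// => /lt_le_trans - /(_ _ (truncnS_gt _)).
by rewrite ltxx.
Qed.

Lemma gap_seq_dgad : (forall e, 0 < e -> exists y, gam y < e) ->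
  dgad_seq gap_seq.
Proof.
move=> gam0; split; [|split; [|split]].
- exact: gap_seq_ltS.
- exact: gap_seq_unbounded.
- move=> n; rewrite !gap_seqS; have := gam_ninc _ _ (ltW (gap_seq_ltS n)).
  by rewrite gap_seqS; lra.
- apply/cvgrPdist_lt => e /gam0 [y ye].
  have [n yn] := gap_seq_unbounded y; near=> m.
  rewrite gap_seqS sub0r normrN addrC addKr gtr0_norm//.
  apply: le_lt_trans ye; apply: gam_ninc; apply: le_trans (ltW yn) _.
  by apply: gap_seq_le; near: m; exact: nbhs_infty_ge.
Unshelve. all: by end_near. Qed.

Lemma gap_seq_crossing a : 0 < a -> exists m, gap_seq m < a <= gap_seq m.+1.
Proof.
move=> a0; have ex : exists n, a <= gap_seq n.
  by have [n /ltW an] := gap_seq_unbounded a; exists n.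
case: (ex_minnP ex) => -[|m] am minm.
  by move: am; rewrite leNgt a0.
exists m; rewrite am andbT ltNge; apply/negP => /minm.
by rewrite ltnn.
Qed.

Section constant_gap.
Variables a b c : R.
Hypothesis gamE : forall y, a <= y < b -> gam y = c.

Lemma gap_seq_arith m i : a <= gap_seq m -> gap_seq (m + i) < b ->
  gap_seq (m + i) = gap_seq m + i%:R * c.
Proof.
move=> am; elim: i => [|i IH]; first by rewrite addn0 mul0r addr0.
rewrite addnS => ib.
have ib' := lt_trans (gap_seq_ltS (m + i)) ib.
rewrite gap_seqS gamE ?ib' ?andbT; last first.
  by apply: le_trans am _; apply: gap_seq_le; exact: leq_addr.
by rewrite IH// -natr1 mulrDl mul1r addrA.
Qed.

(** Here only the predicted value, not the term itself, is known to lie below b. *)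
Lemma gap_seq_arith_fwd m i : 0 <= c -> a <= gap_seq m ->
  gap_seq m + i%:R * c < b -> gap_seq (m + i) = gap_seq m + i%:R * c.
Proof.
move=> c0 am ib; apply: gap_seq_arith => //.
elim: i ib => [|i IH]; first by rewrite mul0r addr0 addn0.
rewrite -natr1 mulrDl mul1r addrA => ib.
have /IH ib' : gap_seq m + i%:R * c < b by lra.
rewrite addnS gap_seqS gamE ?ib' ?andbT; last first.
  by apply: le_trans am _; apply: gap_seq_le; exact: leq_addr.
by rewrite gap_seq_arith.
Qed.

Lemma gap_seq_congr m m' : a <= gap_seq m < b -> a <= gap_seq m' < b ->
  exists k : int, gap_seq m' = gap_seq m + k%:~R * c.
Proof.
move=> /andP[am mb] /andP[am' mb'].
have [mm'|/ltnW m'm] := leqP m m'.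
  exists (m' - m)%:Z; have := gap_seq_arith m (m' - m) am.
  by rewrite subnKC// => ->.
exists (- (m - m')%:Z); have := gap_seq_arith m' (m - m') am'.
by rewrite subnKC// => /(_ mb) ->; rewrite intrN -pmulrn; ring.
Qed.

End constant_gap.
End gap_driven_sequence.

(** * Series with nonnegative terms *)

Lemma sum_arith_sub_le (R : realType) (u : nat -> R) (i L K : nat) :
  (forall n, 0 <= u n) -> (0 < L)%N ->
  \sum_(0 <= k < K) u (i + k * L)%N <= \sum_(i <= n < i + K * L) u n.
Proof.
move=> u0 L0; elim: K => [|K IH]; first by rewrite !big_geq// mul0n addn0.
rewrite big_nat_recr//= mulSnr addnA.
rewrite [leRHS](@big_cat_nat _ _ _ (i + K * L)%N)//= ?leq_addr//.
apply: lerD => //.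
rewrite -[X in \sum_(_ <= _ < _ + X) _]prednK// addnS.
rewrite big_nat_recl ?leq_addr// lerDl.
exact: sumr_ge0.
Qed.

Lemma nneseries_eqy (R : realType) (u : nat -> R) : (forall n, 0 <= u n) ->
  (forall m, exists n, 1 <= \sum_(m <= k < n) u k) ->
  (\sum_(0 <= n <oo) (u n)%:E = +oo)%E.
Proof.
move=> u0 ub.
have big (l : nat) : exists n, l%:R <= \sum_(0 <= k < n) u k.
  elim: l => [|l [m IH]]; first by exists 0%N; rewrite big_geq.
  have [n mn] := ub m; exists n.
  have [nm|/ltnW mn'] := leqP n m.
    by move: mn; rewrite big_geq// ler10.
  by rewrite (@big_cat_nat _ _ _ m)//= -natr1 lerD.
apply/eqyP => A A0; have [n ln] := big (Num.truncn A).+1.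
apply: le_trans; last first.
  by apply: (@nneseries_lim_ge _ _ _ _ n) => k _ _; rewrite lee_fin.
rewrite sumEFin lee_fin; apply: le_trans ln.
exact/ltW/truncnS_gt.
Qed.

Lemma nneseries_lty (R : realType) (u : nat -> R) (m : nat) :
  (forall n, (m <= n)%N -> u n = 0) ->
  (\sum_(0 <= n <oo) (u n)%:E < +oo)%E.
Proof.
move=> u0; have -> : (\sum_(0 <= n <oo) (u n)%:E =
    \sum_(0 <= n < m) (u n)%:E)%E.
  apply: lim_near_cst => //.
  near=> n; have mn : (m <= n)%N by near: n; exact: nbhs_infty_ge.
  rewrite (@big_cat_nat _ _ _ m)//= [X in (_ + X)%E]big_nat_cond.
  rewrite [X in (_ + X)%E]big1 ?adde0//.
  by move=> k /andP[/andP[mk _] _]; rewrite u0.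
by rewrite sumEFin ltry.
Unshelve. all: by end_near. Qed.

(** * The blocks *)

(** Quadratic growth keeps apart blocks that reach about n away from their positions. [blk_mult]
    offsets the damping 1/(1 + |y|). [blk_ratio] is N - 1; its factor 3 (2 n + 5) cancels the
    constant 2 b + 3 of [periodic_cover] at b = n + 1 and the 3 of the piece length 3 eta, leaving
    2^-n. *)
Definition blk_pos (n : nat) : nat := (4 * (n + 2) ^ 2)%N.
Definition blk_mult (n : nat) : nat := (blk_pos n + 2)%N.
Definition blk_ratio (n : nat) : nat := (3 * (2 * n + 5) * 2 ^ n)%N.

Section blocks.
Context {R : realType}.
Implicit Types (n m : nat) (x y : R).

Notation pos n := ((blk_pos n)%:R : R).
Notation mult n := ((blk_mult n)%:R : R).
Notation ratio n := ((blk_ratio n)%:R : R).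

(* [blk_gap n] and [blk_eta n] are the D and eta of block n. *)
Fixpoint blk_gap n : R :=
  if n is m.+1 then
    ratio m * (blk_gap m / (4 * mult m * (ratio m + 1) ^+ 2))
  else 4^-1.

Definition blk_eta n : R := blk_gap n / (4 * mult n * (ratio n + 1) ^+ 2).

(* Block n serves the interval with centre k/(l+1) and radius 1/(l+1), where n
   encodes the pair (k, l); centres that are too large for the block are moved
   to 0, which affects each pair only if its code is small. *)
Definition blk_rad n : R :=
  if (unpickle n : option (int * nat)) is Some (_, l) then l.+1%:R^-1 else 1.

Definition blk_ctr n : R :=
  if (unpickle n : option (int * nat)) is Some (k, l) then
    let c := k%:~R / l.+1%:R in
    if `|c| <= n%:R then c else 0
  else 0.

(** The stretch of gap d. The margin of two gaps leaves room for the overshoot on entering it and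
    for the length of the target at its end. *)
Definition blk_lo n : R := pos n - blk_ctr n - blk_rad n - 2 * blk_gap n.
Definition blk_hi n : R := pos n - blk_ctr n + blk_rad n + 2 * blk_gap n.

Lemma blk_mult_ge2 n : 2 <= mult n.
Proof. by rewrite ler_nat /blk_mult leq_addl. Qed.

Lemma blk_ratio_ge n : 3 * (2 * n%:R + 5) <= ratio n.
Proof.
rewrite -[5]/(5%:R) -natrM -natrD -natrM ler_nat /blk_ratio.
by rewrite leq_pmulr// expn_gt0.
Qed.

Lemma blk_ratio_ge15 n : 15 <= ratio n.
Proof. by have := blk_ratio_ge n; have := ler0n R n; lra. Qed.

(** The last gap d' of a block is the first gap D of the next one. *)
Lemma blk_gapS n : blk_gap n.+1 = ratio n * blk_eta n.
Proof. by []. Qed.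

Lemma blk_etaE n : 4 * mult n * (ratio n + 1) ^+ 2 * blk_eta n = blk_gap n.
Proof.
rewrite /blk_eta mulrC divfK//.
have := blk_mult_ge2 n; have := blk_ratio_ge15 n => r15 m2.
by rewrite !mulf_neq0// ?expf_neq0// gt_eqF//; lra.
Qed.

Lemma blk_gap_gt0 n : 0 < blk_gap n.
Proof.
elim: n => [|n IH]; first by rewrite /= invr_gt0.
have := blk_mult_ge2 n; have := blk_ratio_ge15 n => r15 m2.
rewrite /= mulr_gt0//; first by lra.
by rewrite divr_gt0// mulr_gt0 ?exprn_gt0//; lra.
Qed.

Lemma blk_eta_gt0 n : 0 < blk_eta n.
Proof.
have := blk_mult_ge2 n; have := blk_ratio_ge15 n => r15 m2.
by rewrite /blk_eta divr_gt0 ?blk_gap_gt0// mulr_gt0 ?exprn_gt0//; lra.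
Qed.

(* [t] will be the number of a piece; eta is chosen so that the whole target
   has diameter at most a quarter of the preceding gap. *)
Lemma blk_span n (t : R) : 0 <= t <= mult n * (ratio n + 1) ->
  t * (ratio n * blk_eta n) + 2 * blk_eta n <= blk_gap n / 4.
Proof.
have := blk_mult_ge2 n; have := blk_ratio_ge15 n => r15 m2 /andP[t0 tm].
have e0 := blk_eta_gt0 n; rewrite -(blk_etaE n).
have -> : 4 * mult n * (ratio n + 1) ^+ 2 * blk_eta n / 4 =
  (mult n * (ratio n + 1)) * ratio n * blk_eta n +
  mult n * (ratio n + 1) * blk_eta n by field.
apply: lerD.
  by rewrite -mulrA ler_wpM2r// mulr_ge0 ?ltW//; lra.
rewrite ler_wpM2r//; first exact: ltW.
have : 2 * 1 <= mult n * (ratio n + 1) by apply: ler_pM => //; lra.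
by rewrite mulr1.
Qed.

Lemma blk_fine_le n : (ratio n + 1) * blk_eta n <= blk_gap n / 4.
Proof.
have := blk_mult_ge2 n; have := blk_ratio_ge15 n => r15 m2.
have e0 := blk_eta_gt0 n.
have two : 2 * 1 <= mult n * (ratio n + 1) by apply: ler_pM => //; lra.
have := blk_span n 2; have : 0 <= (2 : R) <= mult n * (ratio n + 1).
  by apply/andP; split; lra.
move=> two' /(_ two').
have : 0 <= ratio n * blk_eta n by rewrite mulr_ge0 ?ltW//; lra.
by lra.
Qed.

Lemma blk_gapS_le n : blk_gap n.+1 <= blk_gap n / 4.
Proof.
rewrite blk_gapS; have := blk_fine_le n; have := blk_eta_gt0 n; lra.
Qed.

Lemma blk_gap_ninc m n : (m <= n)%N -> blk_gap n <= blk_gap m.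
Proof.
elim: n => [|n IH]; first by rewrite leqn0 => /eqP->.
rewrite leq_eqVlt => /predU1P[->//|/IH].
by have := blk_gapS_le n; have := blk_gap_gt0 n; lra.
Qed.

Lemma blk_gap_le n : blk_gap n <= 4^-1.
Proof. exact: (blk_gap_ninc 0%N). Qed.

Lemma blk_gap_lt_inv n : blk_gap n * n.+1%:R <= 1.
Proof.
elim: n => [|n IH]; first by rewrite /=; lra.
have D0 := blk_gap_gt0 n; have n0 := ler0n R n.
have Dn : 0 <= blk_gap n * n%:R by rewrite mulr_ge0// ltW.
have n2 : 0 <= n.+2%:R :> R by [].
apply: le_trans (ler_wpM2r n2 (blk_gapS_le n)) _.
have -> : n.+2%:R = n%:R + 2 :> R by rewrite -addn2 natrD.
by move: IH; rewrite -natr1 mulrDr mulr1; lra.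
Qed.

Lemma blk_gap_small (e : R) : 0 < e ->
  exists n0, forall n, (n0 <= n)%N -> blk_gap n < e.
Proof.
move=> e0; exists (Num.truncn e^-1) => n n0n.
have := blk_gap_lt_inv n; rewrite -ler_pdivlMr// mul1r => /le_lt_trans; apply.
rewrite invf_plt ?posrE//; apply: lt_le_trans (truncnS_gt _) _.
by rewrite ler_nat.
Qed.

Lemma blk_rad_itv n : 0 < blk_rad n <= 1.
Proof.
rewrite /blk_rad; case: (unpickle n : option (int * nat)) => [[k l]|].
  by rewrite invr_gt0 ltr0n/= invf_le1// ler1n.
by rewrite ltr01 lexx.
Qed.

Lemma blk_ctr_itv n : - n%:R <= blk_ctr n <= n%:R.
Proof.
rewrite /blk_ctr; case: (unpickle n : option (int * nat)) => [[k l]|].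
  case: ifPn => [|_]; first by rewrite ler_norml.
  by rewrite oppr_le0 ler0n.
by rewrite oppr_le0 ler0n.
Qed.

(** Equivalently, the windows of radius n + 3 around [pos n] do not overlap. *)
Lemma blk_pos_sep m n : (m < n)%N ->
  pos m + m%:R + n%:R + 6 <= pos n.
Proof.
move=> mn; rewrite -!natrD ler_nat /blk_pos.
have [k ->] : exists k, n = (m + k.+1)%N by exists (n - m.+1)%N; lia.
nia.
Qed.

Lemma blk_pos_ge n : 4 * n%:R + 16 <= pos n.
Proof. by rewrite -natrM -natrD ler_nat /blk_pos; nia. Qed.

Lemma blk_lo_ge n : pos n - n%:R - 2 <= blk_lo n.
Proof.
have := blk_gap_le n; have /andP[? ?] := blk_rad_itv n.
have /andP[? ?] := blk_ctr_itv n; rewrite /blk_lo; lra.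
Qed.

Lemma blk_hi_le n : blk_hi n <= pos n + n%:R + 2.
Proof.
have := blk_gap_le n; have /andP[? ?] := blk_rad_itv n.
have /andP[? ?] := blk_ctr_itv n; rewrite /blk_hi; lra.
Qed.

Lemma blk_lo_hi n : blk_lo n < blk_hi n.
Proof.
have := blk_gap_gt0 n; have /andP[? ?] := blk_rad_itv n.
by rewrite /blk_lo /blk_hi; lra.
Qed.

(** * The gap function and its sequence *)

Lemma blk_hi_unbounded y : exists n, y < blk_hi n.
Proof.
exists (Num.truncn y).
have := truncnS_gt y; rewrite -natr1; set n := Num.truncn y.
have := blk_lo_hi n; have := blk_lo_ge n; have := blk_pos_ge n.
by have := ler0n R n; lra.
Qed.

Definition blk_idx y : nat := ex_minn (blk_hi_unbounded y).

(** No case for d' is needed: past [blk_hi n] the index is that of a later block, whose first gap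
    takes over. *)
Definition blk_step y : R :=
  if y < blk_lo (blk_idx y) then blk_gap (blk_idx y)
  else (ratio (blk_idx y) + 1) * blk_eta (blk_idx y).

Lemma blk_idxE n y : y < blk_hi n -> (forall m, (m < n)%N -> blk_hi m <= y) ->
  blk_idx y = n.
Proof.
move=> yn ym; rewrite /blk_idx; case: ex_minnP => k yk mink.
apply/eqP; rewrite eqn_leq mink//= leqNgt; apply/negP => /ym.
by rewrite leNgt yk.
Qed.

Lemma blk_step_gt0 y : 0 < blk_step y.
Proof.
rewrite /blk_step; case: ifP => _; first exact: blk_gap_gt0.
by rewrite mulr_gt0 ?blk_eta_gt0// ltr_wpDl.
Qed.

Lemma blk_step_le_gap y : blk_step y <= blk_gap (blk_idx y).
Proof.
rewrite /blk_step; case: ifP => // _.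
by have := blk_fine_le (blk_idx y); have := blk_gap_gt0 (blk_idx y); lra.
Qed.

Lemma blk_step_ge_gapS y : blk_gap (blk_idx y).+1 <= blk_step y.
Proof.
rewrite /blk_step; case: ifP => _.
  by have := blk_gapS_le (blk_idx y); have := blk_gap_gt0 (blk_idx y); lra.
by rewrite blk_gapS ler_wpM2r ?ltW ?blk_eta_gt0//; lra.
Qed.

Lemma blk_idx_mono x y : x <= y -> (blk_idx x <= blk_idx y)%N.
Proof.
move=> xy; rewrite {1}/blk_idx; case: ex_minnP => k _; apply.
by apply: le_lt_trans xy _; rewrite /blk_idx; case: ex_minnP.
Qed.

(** Within a block the gap drops from D to d; a later block starts with a gap at most d', which is
    below both values of the earlier one. *)
Lemma blk_step_ninc x y : x <= y -> blk_step y <= blk_step x.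
Proof.
move=> xy; have := blk_idx_mono _ _ xy; rewrite leq_eqVlt => /predU1P[xyE|lt_xy].
  rewrite /blk_step -xyE; case: ifPn => [yl|_].
    by rewrite (le_lt_trans xy).
  case: ifP => // _; have := blk_fine_le (blk_idx x).
  by have := blk_gap_gt0 (blk_idx x); lra.
apply: le_trans (blk_step_le_gap y) _; apply: le_trans (blk_step_ge_gapS x).
exact: blk_gap_ninc.
Qed.

Lemma blk_hi_pos_le m n y : (m < n)%N -> pos n - n%:R - 3 <= y ->
  blk_hi m <= y.
Proof.
by move=> mn yn; have := blk_pos_sep _ _ mn; have := blk_hi_le m; lra.
Qed.

Lemma blk_step_right n y : pos n - n%:R - 3 <= y < blk_lo n ->
  blk_step y = blk_gap n.
Proof.
move=> /andP[ny yn]; have yE : blk_idx y = n.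
  apply: blk_idxE; first exact: lt_trans yn (blk_lo_hi n).
  by move=> m mn; exact: blk_hi_pos_le mn ny.
by rewrite /blk_step yE yn.
Qed.

Lemma blk_step_mid n y : blk_lo n <= y < blk_hi n ->
  blk_step y = (ratio n + 1) * blk_eta n.
Proof.
move=> /andP[ny yn]; have yE : blk_idx y = n.
  apply: blk_idxE => // m mn; apply: blk_hi_pos_le mn _.
  by have := blk_lo_ge n; lra.
by rewrite /blk_step yE ltNge ny.
Qed.

Lemma blk_step_left n y : blk_hi n <= y < pos n + n%:R + 3 ->
  blk_step y = ratio n * blk_eta n.
Proof.
move=> /andP[ny yn].
have := blk_pos_sep _ _ (ltnSn n); rewrite -natr1 => sep.
have lo := blk_lo_ge n.+1; rewrite -natr1 in lo.
have ylo : y < blk_lo n.+1 by lra.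
have yE : blk_idx y = n.+1.
  apply: blk_idxE; first exact: lt_trans ylo (blk_lo_hi _).
  move=> m; rewrite ltnS leq_eqVlt => /predU1P[->//|mn].
  by have := blk_pos_sep _ _ mn; have := blk_hi_le m; have := blk_lo_ge n;
    have := blk_lo_hi n; lra.
by rewrite /blk_step yE ylo blk_gapS.
Qed.

Lemma blk_step_small (e : R) : 0 < e -> exists y, blk_step y < e.
Proof.
move=> /blk_gap_small[n /(_ _ (leqnn _)) ne]; exists (pos n - n%:R - 3).
rewrite (@blk_step_right n)// lexx/=.
by have := blk_lo_ge n; lra.
Qed.

Definition blk_seq : nat -> R := gap_seq blk_step.

Lemma blk_seq_dgad : dgad_seq blk_seq.
Proof.
exact: gap_seq_dgad blk_step_gt0 blk_step_ninc blk_step_small.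
Qed.

(** All gaps are at most 1/4, so the last term before [blk_lo n] already lies where the gap is D,
    and the overshoot is at most D. *)
Lemma blk_seq_enter n :
  exists i, blk_lo n <= blk_seq i <= blk_lo n + blk_gap n.
Proof.
have lo := blk_lo_ge n; have pn := blk_pos_ge n; have n0 := ler0n R n.
have [|i /andP[il li]] := @gap_seq_crossing _ _ blk_step_gt0 blk_step_ninc (blk_lo n).
  by lra.
exists i.+1; rewrite li/=; move: li; rewrite /blk_seq gap_seqS => li.
have := blk_step_le_gap (gap_seq blk_step i); have := blk_gap_le (blk_idx (gap_seq blk_step i)).
move=> h1 h2; rewrite (@blk_step_right n); first by lra.
by rewrite il andbT; lra.
Qed.

(** For each l the fraction floor(x (l + 1)) / (l + 1) is close enough to x. The codes of these
    pairs are distinct, hence some are large, and a large code rules out the replacement of the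
    centre by 0. *)
Lemma blk_ctr_infinitely_often x m (e : R) : 0 < e ->
  exists2 n, (m <= n)%N & `|x - blk_ctr n| <= blk_rad n < e.
Proof.
move=> e0; pose code l := pickle (Num.floor (x * l.+1%:R) : int, l : nat).
have code_inj : injective code.
  by move=> l l' /(pcan_inj pickleK) [].
pose M := (m + (Num.truncn (`|x| + 1)).+1)%N.
have [l [le Ml]] : exists l, ((Num.truncn e^-1) <= l)%N /\ (M <= code l)%N.
  (* Pigeonhole: M + 1 distinct codes cannot all lie below M. *)
  apply: contrapT => /forallNP H.
  pose l0 := Num.truncn e^-1.
  have sub : {subset [seq code (l0 + i)%N | i <- iota 0 M.+1] <= iota 0 M}.
    move=> _ /mapP[i _ ->]; rewrite mem_iota add0n leq0n/= ltnNge.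
    by apply/negP => Mc; apply: (H (l0 + i)%N); split=> //; exact: leq_addr.
  have := uniq_leq_size _ sub; rewrite size_map !size_iota ltnn.
  suff -> : uniq [seq code (l0 + i)%N | i <- iota 0 M.+1] by move=> /(_ isT).
  rewrite map_inj_uniq ?iota_uniq// => i j /code_inj/eqP.
  by rewrite eqn_add2l => /eqP.
exists (code l); first by apply: leq_trans Ml; exact: leq_addr.
have l0 : 0 < l.+1%:R :> R by rewrite ltr0n.
have /andP[fx xf] := floor_itv (x * l.+1%:R).
have radE : blk_rad (code l) = l.+1%:R^-1 by rewrite /blk_rad pickleK.
have close : 0 <= x - (Num.floor (x * l.+1%:R))%:~R / l.+1%:R <= l.+1%:R^-1.
  rewrite subr_ge0 ler_pdivrMr// fx/= lerBlDr.
  rewrite -[X in X + _]mul1r -mulrDl ler_pdivlMr//.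
  by move: xf; rewrite intrD; lra.
have ctrE : blk_ctr (code l) = (Num.floor (x * l.+1%:R))%:~R / l.+1%:R.
  rewrite /blk_ctr pickleK/=; case: ifPn => // /negP[].
  apply: (@le_trans _ _ M%:R); last by rewrite ler_nat.
  rewrite /M natrD; have := truncnS_gt (`|x| + 1); have := ler0n R m.
  have l1 : l.+1%:R^-1 <= 1 :> R by rewrite invf_le1// ler1n.
  move: close => /andP[c0 /le_trans/(_ l1) c1].
  set c := _ / _ in c0 c1 *; have : `|c| <= `|x| + `|x - c|.
    by rewrite -{1}(subKr x c) (le_trans (ler_normB _ _)).
  by rewrite (ger0_norm c0); move: (_.+1%:R) => t; lra.
rewrite radE ctrE ger0_norm; last by case/andP: close.
case/andP: close => _ ->/=; rewrite invf_plt ?posrE//.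
by apply: lt_le_trans (truncnS_gt _) _; rewrite ler_nat.
Qed.

End blocks.

(** * The targets *)

Section targets.
Context {R : realType}.
Implicit Types (n m : nat) (x y : R).
Notation mu := (@lebesgue_measure R).
Notation pos n := ((blk_pos n)%:R : R).
Notation mult n := ((blk_mult n)%:R : R).
Notation ratio n := ((blk_ratio n)%:R : R).

(** There are [blk_mult n] periods of N pieces each, one hit per period. *)
Definition blk_count n : nat := (blk_mult n * (blk_ratio n).+1)%N.
Definition blk_left n (j : nat) : R := pos n + j%:R * (ratio n * blk_eta n).

(** Three nested targets: the core provides the hits, the hull will contain the support, and the
    open set in between separates them for Urysohn's lemma. *)
Definition blk_core n : set R :=
  \bigcup_(j in `I_(blk_count n)) `[blk_left n j, blk_left n j + blk_eta n]%classic.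
Definition blk_nbhd n : set R :=
  \bigcup_(j in `I_(blk_count n))
    `]blk_left n j - blk_eta n, blk_left n j + 2 * blk_eta n[%classic.
Definition blk_hull n : set R :=
  \bigcup_(j in `I_(blk_count n))
    `[blk_left n j - blk_eta n, blk_left n j + 2 * blk_eta n]%classic.

Lemma blk_core_closed n : closed (blk_core n).
Proof.
apply: closed_bigcup; first exact: finite_II.
by move=> j _; exact: interval_closed.
Qed.

Lemma blk_hull_closed n : closed (blk_hull n).
Proof.
apply: closed_bigcup; first exact: finite_II.
by move=> j _; exact: interval_closed.
Qed.

Lemma blk_nbhd_open n : open (blk_nbhd n).
Proof. by apply: bigcup_open => j _; exact: interval_open. Qed.

Lemma blk_core_nbhd n : blk_core n `<=` blk_nbhd n.
Proof.
move=> y [j jn]/=; rewrite in_itv/= => /andP[h1 h2]; exists j => //=.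
by rewrite in_itv/=; have := blk_eta_gt0 (R := R) n => e0; apply/andP; split; lra.
Qed.

Lemma blk_nbhd_hull n : blk_nbhd n `<=` blk_hull n.
Proof.
move=> y [j jn]/=; rewrite in_itv/= => /andP[h1 h2]; exists j => //=.
by rewrite in_itv/= !ltW.
Qed.

Lemma blk_eta_le n : blk_eta n <= blk_gap n / 4 :> R.
Proof.
have := blk_fine_le (R := R) n; have e0 := blk_eta_gt0 (R := R) n.
have : 0 <= ratio n * blk_eta n by rewrite mulr_ge0// ltW.
by lra.
Qed.

Lemma blk_left_span n j : (j < blk_count n)%N ->
  pos n <= blk_left n j /\ blk_left n j + 2 * blk_eta n <= pos n + blk_gap n / 4.
Proof.
move=> jn; have e0 := blk_eta_gt0 (R := R) n.
have : 0 <= j%:R * (ratio n * blk_eta n) by rewrite mulr_ge0// mulr_ge0// ltW.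
have := @blk_span R n j%:R; rewrite ler0n/= => h h'.
rewrite /blk_left; split; first by lra.
rewrite -addrA lerD2l; apply: h.
by rewrite natr1 -natrM ler_nat ltnW.
Qed.

Lemma blk_hull_itv n y : blk_hull n y ->
  pos n - blk_gap n / 4 <= y <= pos n + blk_gap n / 4.
Proof.
move=> [j /blk_left_span[h1 h2]]/=; rewrite in_itv/= => /andP[h3 h4].
by have := blk_eta_le n => h5; apply/andP; split; lra.
Qed.

Lemma blk_hull_ge n y : blk_hull n y -> pos n - 1 <= y.
Proof. by move=> /blk_hull_itv/andP[h _]; have := blk_gap_le (R := R) n; lra. Qed.

Lemma blk_hull_le n y : blk_hull n y -> y <= pos n + 1.
Proof. by move=> /blk_hull_itv/andP[_ h]; have := blk_gap_le (R := R) n; lra. Qed.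

(* With N = ratio + 1, the middle stretch of the sequence has gap N eta while
   the pieces are (N - 1) eta apart: the i-th term lands in the j-th piece as
   soon as i N - j (N - 1) equals a suitable integer u, and the solutions (i, j)
   recur with period (N - 1, N). *)
Lemma blk_core_hits n x : `|x - blk_ctr n| <= blk_rad n ->
  exists i : nat, forall k, (k < blk_mult n)%N ->
    blk_core n (x + blk_seq (i + k * blk_ratio n)%N).
Proof.
rewrite ler_norml => /andP[xl xr].
have [i0 /andP[l0 l1]] := blk_seq_enter (R := R) n.
have D0 := blk_gap_gt0 (R := R) n; have e0 := blk_eta_gt0 (R := R) n.
set t0 := blk_seq i0 in l0 l1.
(* The distance from [t0] to the first piece as seen from x, in units of eta. Its rounding u is such
   that a shift by u eta lands in that piece. *)
pose z := (pos n - x - t0) / blk_eta n.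
have z0 : 0 <= z.
  by rewrite divr_ge0// ?ltW//; move: l1; rewrite /blk_lo; lra.
have zE : z * blk_eta n = pos n - x - t0 by rewrite divfK// gt_eqF.
pose u := (Num.truncn z).+1.
have zu : z <= u%:R by rewrite ltW// truncnS_gt.
have uz : u%:R <= z + 1.
  by rewrite /u -natr1 lerD2r truncn_le.
pose N := (blk_ratio n).+1.
(* With u = q N + r, the pair i = q + r, j = r solves i N = u + j (N - 1). *)
exists (i0 + (u %/ N + u %% N))%N => k kK.
rewrite -addnA; set i := (_ + k * _)%N.
pose j := (u %% N + k * N)%N.
have ijE : (i * N = u + j * blk_ratio n)%N.
  rewrite /i /j {3}(divn_eq u N).
  by move: (u %/ N)%N (u %% N)%N => p q; rewrite /N; lia.
have jn : (j < blk_count n)%N.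
  rewrite /j /blk_count -/N.
  have uN : (u %% N < N)%N by rewrite ltn_mod.
  by apply: leq_trans (_ : k.+1 * N <= _)%N; [lia|rewrite leq_mul2r kK orbT].
have [jl jr] := blk_left_span _ _ jn.
have iE : i%:R * ((ratio n + 1) * blk_eta n) =
    u%:R * blk_eta n + j%:R * (ratio n * blk_eta n).
  by rewrite mulrA natr1 -natrM ijE natrD natrM; ring.
have ze : z * blk_eta n <= u%:R * blk_eta n by rewrite ler_wpM2r// ltW.
have ez : u%:R * blk_eta n <= z * blk_eta n + blk_eta n.
  by rewrite -[X in _ + X]mul1r -mulrDl ler_wpM2r// ltW.
rewrite /blk_left in jl jr.
rewrite /blk_seq (@gap_seq_arith_fwd _ _ blk_step_gt0 _ _ _ (@blk_step_mid R n))//.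
- exists j => //=; rewrite in_itv/= iE -/(blk_seq i0) -/t0 /blk_left; apply/andP; split; lra.
- by rewrite mulr_ge0 ?ltW// ltr_wpDl.
- by rewrite iE -/(blk_seq i0) -/t0 /blk_hi; lra.
Qed.

Lemma blk_ratioE n : ratio n = 3 * (2 * n%:R + 5) * 2 ^+ n.
Proof. by rewrite /blk_ratio !natrM natrD natrM natrX. Qed.

Lemma blk_seq_section_base (a b c : R) :
  (forall y, a <= y < b -> blk_step y = c) ->
  exists t : R, forall m, a <= blk_seq m < b ->
    exists k : int, blk_seq m = t + k%:~R * c.
Proof.
move=> abc.
have [[m0 m0P]|nm] := pselect (exists m, a <= blk_seq m < b).
  exists (blk_seq m0) => m mP.
  exact: (@gap_seq_congr _ _ blk_step_gt0 _ _ _ abc).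
by exists 0 => m mP; case: nm; exists m.
Qed.

(* Left of the block the sequence is synchronised with the pieces, so the hits
   pile up on a set of density 3/ratio. *)
Lemma blk_hull_left n : exists S : set R, [/\ measurable S,
  (mu S <= (2^-1 ^+ n)%:E)%E &
  forall x m, - (n%:R + 1) <= x < blk_ctr n - blk_rad n - 4 * blk_gap n ->
    blk_hull n (x + blk_seq m) -> S x].
Proof.
have D0 := blk_gap_gt0 (R := R) n; have e0 := blk_eta_gt0 (R := R) n.
have r15 := blk_ratio_ge15 (R := R) n; have D1 := blk_gap_le (R := R) n.
have [t tP] := blk_seq_section_base _ _ _ (@blk_step_left R n).
set d := ratio n * blk_eta n in tP.
have d0 : 0 < d by rewrite mulr_gt0//; lra.
have d1 : d <= 1.
  by rewrite /d; have := blk_fine_le (R := R) n; lra.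
have ed : 3 * blk_eta n <= d by rewrite /d ler_pM2r//; lra.
have n0 := ler0n R n; have n1 : 0 <= n%:R + 1 :> R by lra.
have e3 : 0 <= 3 * blk_eta n :> R by lra.
(* A term t + k d hits the j-th piece when x lies in an interval depending only on j - k, so one
   d-periodic family serves all pieces. *)
have [S [mS muS SP]] := @periodic_cover R (pos n - t - blk_eta n) _ _ _
  d0 d1 e3 ed n1.
exists S; split=> //.
  apply: le_trans muS _; rewrite lee_fin le_eqVlt; apply/orP; left; apply/eqP.
  rewrite /d blk_ratioE exprVn; field.
  by rewrite expf_neq0//= !gt_eqF//; lra.
move=> x m /andP[nx xl] hx.
have /andP[h1 h2] := blk_hull_itv _ _ hx.
have /andP[c1 c2] := blk_ctr_itv (R := R) n.
have /andP[w1 w2] := blk_rad_itv (R := R) n.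
have [|k kE] := tP m.
  by apply/andP; split; rewrite /blk_hi; lra.
case: hx => j _ /=; rewrite in_itv/= /blk_left -/d kE => /andP[h3 h4].
apply: (SP x (j%:Z - k)); first by apply/andP; split; lra.
by rewrite intrB mulrBl -pmulrn; apply/andP; split; lra.
Qed.

(* Right of the block the sequence is so sparse that the total length of the
   pieces is negligible compared to the gap. *)
Lemma blk_hull_right n : exists S : set R, [/\ measurable S,
  (mu S <= (2^-1 ^+ n)%:E)%E &
  forall x m, blk_ctr n + blk_rad n + 4 * blk_gap n < x <= n%:R + 1 ->
    blk_hull n (x + blk_seq m) -> S x].
Proof.
have D0 := blk_gap_gt0 (R := R) n; have e0 := blk_eta_gt0 (R := R) n.
have r15 := blk_ratio_ge15 (R := R) n; have D1 := blk_gap_le (R := R) n.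
have m2 := blk_mult_ge2 (R := R) n.
have [t tP] := blk_seq_section_base _ _ _ (@blk_step_right R n).
have eD := blk_eta_le n; have n0 := ler0n R n.
have n1 : 0 <= n%:R + 1 :> R by lra.
have eD3 : 3 * blk_eta n <= blk_gap n :> R by lra.
have e3 : 0 <= 3 * blk_eta n :> R by lra.
have D1' : blk_gap n <= 1 :> R by lra.
(* The pieces are not spaced by the period D, so each gets its own periodic family, and the measures
   are summed over all pieces. *)
have [F FP] := choice (fun j => @periodic_cover R (blk_left n j - blk_eta n - t)
  (blk_gap n) (3 * blk_eta n) (n%:R + 1) D0 D1' e3 eD3 n1).
exists (\big[setU/set0]_(j < blk_count n) F j); split.
- by apply: bigsetU_measurable => j _; have [] := FP j.
- apply: le_trans.
    by apply: (@Boole_inequality _ _ _ mu F) => j _; have [] := FP j.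
  apply: (@le_trans _ _ (\sum_(j < blk_count n)
     ((2 * (n%:R + 1) + 3) * (3 * blk_eta n / blk_gap n))%:E)%E).
    by apply: lee_sum => j _; have [] := FP j.
  rewrite sumEFin sumr_const card_ord lee_fin -[leLHS]mulr_natl.
  rewrite /blk_count natrM -[(blk_ratio n).+1%:R]natr1 -(blk_etaE n) exprVn.
  have -> : mult n * (ratio n + 1) * ((2 * (n%:R + 1) + 3) * (3 * blk_eta n /
      (4 * mult n * (ratio n + 1) ^+ 2 * blk_eta n))) =
      (3 * (2 * n%:R + 5)) / (4 * (ratio n + 1)) :> R.
    by field; rewrite !gt_eqF//; lra.
  rewrite ler_pdivrMr; last by lra.
  rewrite ler_pdivlMl ?exprn_gt0// mulrC -blk_ratioE; lra.
- move=> x m /andP[xl nx] hx.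
  have /andP[h1 h2] := blk_hull_itv _ _ hx.
  have /andP[c1 c2] := blk_ctr_itv (R := R) n.
  have /andP[w1 w2] := blk_rad_itv (R := R) n.
  have [|k kE] := tP m.
    by apply/andP; split; rewrite /blk_lo; lra.
  case: hx => j jn /=; rewrite in_itv/= kE => /andP[h3 h4].
  rewrite -(bigcup_mkord _ F); exists j => //.
  have [_ _ FPj] := FP j; apply: (FPj x (- k)).
    by apply/andP; split; lra.
  by rewrite intrN mulNr; apply/andP; split; lra.
Qed.

Lemma blk_hull_cover n : exists S : set R, [/\ measurable S,
  (mu S <= (2 * 2^-1 ^+ n)%:E)%E &
  forall x m, `|x| <= n%:R + 1 -> blk_rad n + 4 * blk_gap n < `|x - blk_ctr n| ->
    blk_hull n (x + blk_seq m) -> S x].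
Proof.
have [A [mA muA AP]] := blk_hull_left n; have [B [mB muB BP]] := blk_hull_right n.
exists (A `|` B); split; first exact: measurableU.
  apply: le_trans; first exact: measureU2.
  rewrite (_ : 2 * 2^-1 ^+ n = 2^-1 ^+ n + 2^-1 ^+ n); last by ring.
  by rewrite EFinD leeD.
move=> x m; rewrite ler_norml ltr_normr => /andP[xl xr] /orP[] far hx.
  by right; apply: (BP x m) => //; apply/andP; split; lra.
by left; apply: (AP x m) => //; apply/andP; split; lra.
Qed.

End targets.

(** * The functions attached to an open set *)

Lemma shift_sum_mono (R : realType) (f g : R -> R) (lam : nat -> R) (x : R) :
  (forall y, 0 <= f y <= g y) ->
  shift_sum f lam x = +oo%E -> shift_sum g lam x = +oo%E.
Proof.
move=> fg fy; apply/eqP; rewrite -leye_eq -fy; apply: lee_nneseries.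
- by move=> n _ _; rewrite lee_fin; have /andP[] := fg (x + lam n).
- by move=> n _; rewrite lee_fin; have /andP[] := fg (x + lam n).
Qed.

Lemma continuous_damping (R : realType) (u : R -> R) :
  continuous u -> (forall y, 0 <= u y <= 1) ->
  C0plus (fun y => u y / (1 + `|y|)).
Proof.
move=> cu u01.
have d0 (y : R) : 0 < 1 + `|y| by rewrite ltr_wpDr.
split; [|split].
- move=> y; apply: cvgM; first exact: cu.
  apply: cvgV; first by rewrite gt_eqF.
  by apply: cvgD; [exact: cvg_cst|exact: norm_continuous].
- by move=> y; have /andP[u0 _] := u01 y; rewrite divr_ge0// ltW.
- apply/cvgrPdist_lt => e e0; near=> y.
  have /andP[u0 u1] := u01 y.
  rewrite sub0r normrN ger0_norm; last by rewrite divr_ge0// ltW.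
  rewrite ltr_pdivrMr//; apply: le_lt_trans u1 _.
  rewrite -ltr_pdivrMl// mulr1; apply: lt_le_trans (_ : y <= _).
    by near: y; apply: nbhs_pinfty_gt; rewrite num_real.
  by have := ler_norm y; lra.
Unshelve. all: by end_near. Qed.

Section open_set.
Context {R : realType} (G : set R).
Hypothesis oG : open G.
Implicit Types (n m : nat) (x y : R).
Notation mu := (@lebesgue_measure R).

(** The margin of four gaps is that of [blk_hull_cover], which therefore applies to every x outside
    G in each selected block. *)
Definition blk_sel : set nat :=
  [set n | forall y, `|y - blk_ctr n| <= blk_rad n + 4 * blk_gap n -> G y].

Definition sel_core : set R := \bigcup_(n in blk_sel) blk_core n.
Definition sel_nbhd : set R := \bigcup_(n in blk_sel) blk_nbhd n.
Definition sel_hull : set R := \bigcup_(n in blk_sel) blk_hull n.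

Lemma blk_hull_escape n y : blk_hull n y -> n%:R <= y.
Proof.
by move=> /blk_hull_ge; have := blk_pos_ge (R := R) n; have := ler0n R n; lra.
Qed.

Lemma sel_core_closed : closed sel_core.
Proof.
apply: closed_bigcup_escaping => [n _|n y /blk_core_nbhd/blk_nbhd_hull].
  exact: blk_core_closed.
exact: blk_hull_escape.
Qed.

Lemma sel_hull_closed : closed sel_hull.
Proof.
by apply: closed_bigcup_escaping => [n _|]; [exact: blk_hull_closed|exact: blk_hull_escape].
Qed.

Lemma sel_nbhd_open : open sel_nbhd.
Proof. by apply: bigcup_open => n _; exact: blk_nbhd_open. Qed.

Lemma blk_sel_infinitely_often x m : G x ->
  exists n, [/\ blk_sel n, `|x - blk_ctr n| <= blk_rad n & (m <= n)%N].
Proof.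
move=> Gx; have : nbhs x G by exact: open_nbhs_nbhs.
move=> /nbhs_ballP[e /= e0 eG].
(* Points of the enlarged interval are within 2 rad + 4 gap < e/2 + e/4 of x. *)
have e16 : 0 < e / 16 by rewrite divr_gt0.
have e4 : 0 < e / 4 by rewrite divr_gt0.
have [n0 n0P] := blk_gap_small _ e16.
have [n nm /andP[xn rn]] := blk_ctr_infinitely_often x (maxn m n0) _ e4.
exists n; split=> //; last by apply: leq_trans nm; exact: leq_maxl.
move=> y yn; apply: eG; rewrite /ball/=.
have := n0P n (leq_trans (leq_maxr _ _) nm).
have : `|x - y| <= `|x - blk_ctr n| + `|y - blk_ctr n|.
  by rewrite (distrC y) -[x - y](subrKA (blk_ctr n)) ler_normD.
by lra.
Qed.

(** Each selected block serving x yields [blk_mult n] hits, all at height at most [pos n + 1], so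
    each contributes at least 1 / [blk_mult n] and together at least 1. *)
Lemma sel_divergence (g : R -> R) x : (forall y, 0 <= g y) ->
  (forall y, sel_core y -> (1 + `|y|)^-1 <= g y) ->
  G x -> shift_sum g blk_seq x = +oo%E.
Proof.
move=> g0 gcore Gx; apply: nneseries_eqy => // m.
(* A block n >= M lies beyond x + [blk_seq m], so its hits have index at least m. *)
pose M := (Num.truncn (x + blk_seq m)).+1.
have [n [nG xn Mn]] := blk_sel_infinitely_often _ M Gx.
have [i iP] := blk_core_hits _ _ xn.
have K0 : (0 < blk_mult n)%N by rewrite /blk_mult addn_gt0 orbT.
have mi : (m <= i)%N.
  rewrite leqNgt; apply/negP => /ltnW im.
  have := blk_nbhd_hull _ _ (blk_core_nbhd _ _ (iP _ K0)).
  rewrite mul0n addn0 => /blk_hull_ge.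
  have im' : blk_seq i <= blk_seq m :> R by exact: gap_seq_le blk_step_gt0 _ _ im.
  have h : x + blk_seq m < M%:R by exact: truncnS_gt.
  have : M%:R <= n%:R :> R by rewrite ler_nat.
  by have := blk_pos_ge (R := R) n; have := ler0n R n; lra.
have L0 : (0 < blk_ratio n)%N.
  by rewrite -(ltr_nat R); have := blk_ratio_ge15 (R := R) n; lra.
exists (i + blk_mult n * blk_ratio n)%N.
rewrite (@big_cat_nat _ _ _ i)//= ?leq_addr//.
apply: ler_wpDl; first exact: sumr_ge0.
apply: le_trans; last exact: (sum_arith_sub_le _ (fun k => g (x + blk_seq k))).
apply: (@le_trans _ _ (\sum_(0 <= k < blk_mult n) ((blk_mult n)%:R^-1 : R))).
  by rewrite sumr_const_nat subn0 -[leRHS]mulr_natl divff// pnatr_eq0 -lt0n.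
rewrite big_nat_cond [leRHS]big_nat_cond; apply: ler_sum => k /andP[/andP[_ kK] _].
have core := iP _ kK; apply: le_trans (gcore _ _); last by exists n.
have hull := blk_nbhd_hull _ _ (blk_core_nbhd _ _ core).
have := blk_hull_ge _ _ hull; have := blk_hull_le _ _ hull.
set y := x + _; have := blk_pos_ge (R := R) n; have := ler0n R n => n0 p0 h1 h2.
rewrite lef_pV2 ?posrE ?ltr0n ?ltr_wpDr//.
rewrite ger0_norm; last by lra.
have -> : (blk_mult n)%:R = (blk_pos n)%:R + 2 :> R by rewrite /blk_mult natrD.
by lra.
Qed.

(** By Borel-Cantelli almost every x lies in finitely many [F n]. If such an x is outside G, late
    blocks do not hit it and early blocks are eventually left behind, so its sum is finite. *)
Lemma sel_null :
  mu.-negligible [set x | ~ G x /\ shift_sum \1_sel_hull blk_seq x = +oo%E].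
Proof.
have [F FP] := choice (@blk_hull_cover R).
have mF n : measurable (F n) by have [] := FP n.
exists (lim_sup_set F); split.
- by apply: bigcap_measurable => // k _; apply: bigcup_measurable => j _; exact: mF.
- apply: lim_sup_set_cvg0 => //.
  apply: (@le_lt_trans _ _ (\sum_(0 <= n <oo) (2 * 2^-1 ^+ n)%:E)%E).
    by apply: lee_nneseries => // n _; have [] := FP n.
  rewrite (@eq_eseriesr _ _ (fun n => (4 / (2 ^ (n + 1))%:R)%:E)); last first.
    by move=> n _; rewrite natrX addn1 exprS exprVn; congr EFin; field;
      rewrite expf_neq0.
  by rewrite (cvg_lim _ (@cvg_geometric_eseries_half R 4 0))// ltry.
- move=> x [nGx sumx]; apply: contrapT => /existsNP[N /not_implyP[_ nF]].
  suff [m1 m1P] : exists m1, forall m, (m1 <= m)%N ->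
      (\1_sel_hull (x + blk_seq m) : R) = 0.
    have := @nneseries_lty R (fun m => \1_sel_hull (x + blk_seq m)) _ m1P.
    by rewrite /shift_sum in sumx; rewrite sumx ltxx.
  pose M := maxn N (Num.truncn `|x|).
  have [m1 m1P] := gap_seq_unbounded _ (@blk_step_gt0 R) (@blk_step_ninc R)
    ((blk_pos M)%:R + 1 - x).
  exists m1 => m m1m; rewrite indicE memNset//; move=> [n nG hn].
  have [Mn|nM] := leqP M n.
    apply: nF; exists n; first exact: leq_trans (leq_maxl _ _) Mn.
    have [_ _ Fn] := FP n; apply: Fn hn.
      have := truncnS_gt `|x|; rewrite -natr1.
      have : (Num.truncn `|x|)%:R <= n%:R :> R.
        by rewrite ler_nat (leq_trans _ Mn)// leq_maxr.
      by lra.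
    by rewrite ltNge; apply/negP => /nG.
  have := blk_hull_le _ _ hn; have := blk_pos_sep (R := R) _ _ nM.
  have : (blk_pos M)%:R + 1 - x < blk_seq m.
    by apply: lt_le_trans m1P _; exact: gap_seq_le (@blk_step_gt0 R) _ _ m1m.
  by have := ler0n R n; have := ler0n R M; lra.
Qed.

Lemma sel_urysohn : exists u : R -> R, [/\ continuous u,
  forall y, 0 <= u y <= 1, forall y, sel_core y -> u y = 1 &
  forall y, ~ sel_hull y -> u y = 0].
Proof.
have disj : ~` sel_nbhd `&` sel_core = set0.
  apply/seteqP; split=> // y [ny [n nG yn]]; apply: ny.
  by exists n => //; exact: blk_core_nbhd.
have [u [cu u0 u1 u01]] := @urysohn_ext_itv R R (pseudoMetric_normal R R) _ _ 0 1
  (open_closedC sel_nbhd_open) sel_core_closed disj ltr01.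
exists u; split=> //.
- by move=> y; have := u01 (u y) (imageT _ _); rewrite /= in_itv.
- by move=> y cy; apply: u1; exists y.
- move=> y hy; apply: u0; exists y => //; apply: contra_not hy => -[n nG yn].
  by exists n => //; exact: blk_nbhd_hull.
Qed.

End open_set.

Theorem theorem2p1 (R : realType) :
  exists lam : nat -> R, dgad_seq lam /\
    forall G : set R, open G ->
      (exists U : set R, closed U /\ good_for lam G (\1_U : R -> R)) /\
      (exists g : R -> R, C0plus g /\ good_for lam G g).
Proof.
exists blk_seq; split; first exact: blk_seq_dgad.
move=> G oG; have [u [cu u01 u1 u0]] := sel_urysohn G.
pose g y : R := u y / (1 + `|y|).
have d1 (y : R) : 1 <= 1 + `|y| by rewrite lerDl.
(* This comparison transfers divergence on G from g to the indicator and the null set from the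
   indicator to g. *)
have g_hull y : 0 <= g y <= \1_(sel_hull G) y.
  have /andP[uy0 uy1] := u01 y.
  have d0 : 0 < 1 + `|y| by exact: lt_le_trans (d1 y).
  rewrite divr_ge0 ?(ltW d0)//=.
  rewrite indicE; have [/set_mem hy|/negP hy] := boolP (y \in sel_hull G).
    by rewrite ler_pdivrMr//= mul1r (le_trans uy1).
  by rewrite /g u0 ?mul0r// => hy'; apply: hy; rewrite inE.
have g_div x : G x -> shift_sum g blk_seq x = +oo%E.
  apply: sel_divergence => // [y|y cy]; first by have /andP[] := g_hull y.
  by rewrite /g u1// mul1r.
split.
  exists (sel_hull G); split; first exact: sel_hull_closed.
  by split=> [|x /g_div]; [exact: sel_null|exact: shift_sum_mono].
exists g; split; first exact: continuous_damping.
split=> //; apply: negligibleS (sel_null G) => x [nGx gx]; split=> //.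
exact: shift_sum_mono gx.
Qed.
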